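(* Let $\lambda$ be a partition. For each $\mu\in\mathcal{D}(\lambda)$, \[ \sum_{\nu\in\mathcal{U}(\lambda)}\mathcal{P}_\lambda(\mu\rightarrow\nu)=1, \] and for each $\nu\in\mathcal{U}(\lambda)$, \[ \sum_{\mu\in\mathcal{D}^*(\lambda)}\overline{\mathcal{P}}_\lambda(\mu\leftarrow\nu)=1. \]
   Context: Partitions are Young diagrams in French convention (cells $(x,y)\in\mathbb{Z}_{>0}^2$, $x\le\lambda_y$), $\lambda'$ the conjugate. For $c=(x,y)\in\lambda$: $a_\lambda(c)=\lambda_y-x$, $\ell_\lambda(c)=\lambda'_x-y$; $n(\kappa)=\sum_{c\in\kappa}\ell_\kappa(c)$, $n'(\kappa)=\sum_{c\in\kappa}a_\kappa(c)$, and for $\kappa\subseteq\rho$, $n(\rho/\kappa)=n(\rho)-n(\kappa)$, $n'(\rho/\kappa)=n'(\rho)-n'(\kappa)$. $\mathcal{U}(\lambda)$ (resp. $\mathcal{D}(\lambda)$) is the set of partitions obtained by adding (resp. removing) one cell; $\mathcal{D}^*(\lambda)=\mathcal{D}(\lambda)\cup\{\lambda\}$. For $\kappa\subseteq\rho$, $\mathcal{R}_{\rho/\kappa}$ (resp. $\mathcal{C}_{\rho/\kappa}$) is the set of cells of $\kappa$ in a row (resp. column) containing a cell of $\rho/\kappa$. With $[i,j]=1-q^it^j$, for $\kappa$ obtained from $\rho$ by removing one cell: $\alpha_{\rho/\kappa}=\prod_{c\in\mathcal{R}_{\rho/\kappa}}\frac{[a_\kappa(c),\ell_\kappa(c)+1]}{[a_\rho(c),\ell_\rho(c)+1]}\prod_{c\in\mathcal{C}_{\rho/\kappa}}\frac{[a_\kappa(c)+1,\ell_\kappa(c)]}{[a_\rho(c)+1,\ell_\rho(c)]}$,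 $\overline{\alpha}_{\rho/\kappa}=\prod_{c\in\mathcal{R}_{\rho/\kappa}}\frac{[a_\kappa(c)+1,\ell_\kappa(c)]}{[a_\rho(c)+1,\ell_\rho(c)]}\prod_{c\in\mathcal{C}_{\rho/\kappa}}\frac{[a_\kappa(c),\ell_\kappa(c)+1]}{[a_\rho(c),\ell_\rho(c)+1]}$, $\beta_{\rho/\kappa}=1/\alpha_{\rho/\kappa}$, $\overline{\beta}_{\rho/\kappa}=1/\overline{\alpha}_{\rho/\kappa}$. For $\mu\in\mathcal{D}(\lambda)$, $\nu\in\mathcal{U}(\lambda)$ put $A=n'(\lambda/\mu)-n'(\nu/\lambda)$, $B=n(\nu/\lambda)-n(\lambda/\mu)$, $\gamma_{\nu/\lambda/\mu}=\frac{(1-q^At^B)(1-q^{A+1}t^{B-1})}{(1-q)(1-t)}$, and $\mathcal{P}_\lambda(\mu\rightarrow\nu)=t^{B-1}\frac{\alpha_{\nu/\lambda}\beta_{\lambda/\mu}}{\gamma_{\nu/\lambda/\mu}}$, $\overline{\mathcal{P}}_\lambda(\mu\leftarrow\nu)=t^{B-1}\frac{\overline{\alpha}_{\nu/\lambda}\overline{\beta}_{\lambda/\mu}}{\gamma_{\nu/\lambda/\mu}}$. Also $\overline{\mathcal{P}}_\lambda(\lambda\leftarrow\nu)=t^{n(\nu/\lambda)}\overline{\alpha}_{\nu/\lambda}$. *)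

(* Defs.v *)
From HB Require Import structures.
From mathcomp Require Import all_boot all_order all_algebra.
From mathcomp Require Import fraction.
Set Implicit Arguments. Unset Strict Implicit. Unset Printing Implicit Defensive.
Import Order.TTheory GRing.Theory Num.Theory.

(* Partitions: weakly decreasing sequences of positive naturals.
   Row y (y >= 1) has length lambda_y = nth 0 la y.-1.  Cells (x,y), French. *)
Definition is_partition (la : seq nat) : bool :=
  sorted geq la && all (fun p => 0 < p) la.

Definition prow (la : seq nat) (y : nat) : nat := nth 0 la y.-1.
Definition pconj (la : seq nat) (x : nat) : nat := count (fun p => x <= p) la.

Definition cells (la : seq nat) : seq (nat * nat) :=
  flatten [seq [seq (x, y) | x <- iota 1 (prow la y)] | y <- iota 1 (size la)].

Definition arm (la : seq nat) (c : nat * nat) : nat := prow la c.2 - c.1.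
Definition leg (la : seq nat) (c : nat * nat) : nat := pconj la c.1 - c.2.

Definition nfun (la : seq nat) : nat := sumn [seq leg la c | c <- cells la].
Definition nfun' (la : seq nat) : nat := sumn [seq arm la c | c <- cells la].

Definition Uset (la : seq nat) : seq (seq nat) :=
  [seq s <- [seq incr_nth la i | i <- iota 0 (size la).+1] | sorted geq s].

Definition Dset (la : seq nat) : seq (seq nat) :=
  [seq [seq p <- s | 0 < p]
    | s <- [seq set_nth 0 la i (nth 0 la i).-1 | i <- iota 0 (size la)] & sorted geq s].

Definition Dstar (la : seq nat) : seq (seq nat) := la :: Dset la.

Definition skew (rho ka : seq nat) : seq (nat * nat) :=
  [seq c <- cells rho | c \notin cells ka].
Definition Rcells (rho ka : seq nat) : seq (nat * nat) :=
  [seq c <- cells ka | has (fun d => d.2 == c.2) (skew rho ka)].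
Definition Ccells (rho ka : seq nat) : seq (nat * nat) :=
  [seq c <- cells ka | has (fun d => d.1 == c.1) (skew rho ka)].

Local Open Scope ring_scope.

Definition K : fieldType := {fraction {poly {poly rat}}}.
Definition qv : K := @FracField.tofrac _ (('X : {poly rat})%:P : {poly {poly rat}}).
Definition tv : K := @FracField.tofrac _ ('X : {poly {poly rat}}).

Definition br (i j : nat) : K := 1 - qv ^+ i * tv ^+ j.

Definition alpha (rho ka : seq nat) : K :=
  (\prod_(c <- Rcells rho ka) (br (arm ka c) (leg ka c).+1 / br (arm rho c) (leg rho c).+1)) *
  (\prod_(c <- Ccells rho ka) (br (arm ka c).+1 (leg ka c) / br (arm rho c).+1 (leg rho c))).
Definition alphabar (rho ka : seq nat) : K :=
  (\prod_(c <- Rcells rho ka) (br (arm ka c).+1 (leg ka c) / br (arm rho c).+1 (leg rho c))) *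
  (\prod_(c <- Ccells rho ka) (br (arm ka c) (leg ka c).+1 / br (arm rho c) (leg rho c).+1)).
Definition beta (rho ka : seq nat) : K := (alpha rho ka)^-1.
Definition betabar (rho ka : seq nat) : K := (alphabar rho ka)^-1.

Definition nskew (rho ka : seq nat) : int := (nfun rho)%:Z - (nfun ka)%:Z.
Definition nskew' (rho ka : seq nat) : int := (nfun' rho)%:Z - (nfun' ka)%:Z.

Definition Aexp (la mu nu : seq nat) : int := nskew' la mu - nskew' nu la.
Definition Bexp (la mu nu : seq nat) : int := nskew nu la - nskew la mu.

Definition gamma (la mu nu : seq nat) : K :=
  let A := Aexp la mu nu in let B := Bexp la mu nu in
  (1 - qv ^ A * tv ^ B) * (1 - qv ^ (A + 1) * tv ^ (B - 1)) / ((1 - qv) * (1 - tv)).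

Definition Pdown (la mu nu : seq nat) : K :=
  tv ^ (Bexp la mu nu - 1) * (alpha nu la * beta la mu) / gamma la mu nu.

Definition Pbar (la mu nu : seq nat) : K :=
  if mu == la then tv ^ nskew nu la * alphabar nu la
  else tv ^ (Bexp la mu nu - 1) * (alphabar nu la * betabar la mu) / gamma la mu nu.

(* Main.v *)
(** Index rows from 0 and attach to row [k] of [la] the weight
    [U k = t^k / q^(la_k)]; put [n = size la].  The row part of [alpha]
    telescopes over columns of equal height, so that, when [rho] is [ka] plus a
    cell in row [y],
      [t^y * alpha rho ka
         = \prod_(k < n) (U y - s U k) / \prod_(k <= n, k != y) (U y - (s/t) U k)]
    with [s = t]; for [alphabar] the same formula holds with [s = q].  If row
    [y] has no addable cell then [U y = t * U (y-1)], and similarly for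
    removable cells, so both sums may be extended over all rows: the added terms
    vanish.  With [W k = q * U k], both identities are then Lagrange
    interpolation for the leading coefficient: of
    [\prod_(k < n, k != m) (X - t U k)] (degree too small, hence 0) at the nodes
    [U 0, ..., U n, W m], and of [\prod_(k <= n, k != y) (X - (q/t) U k)]
    (monic) at the nodes [W 0, ..., W (n-1), U y]. *)
Require Import Defs.
From mathcomp Require Import all_boot all_order all_algebra.
From mathcomp Require Import fraction zify ring.
Import GRing.Theory.
Set Implicit Arguments. Unset Strict Implicit. Unset Printing Implicit Defensive.

(** * Monotone sequences, conjugates and cells *)

Definition noninc (la : seq nat) := forall i j, i <= j -> nth 0 la j <= nth 0 la i.

Lemma sorted_noninc (la : seq nat) : sorted geq la -> noninc la.
Proof.
move=> la_sorted i j le_ij; have [jn|jn] := ltnP j (size la); last first.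
  by rewrite [nth 0 la j]nth_default.
apply: (@sorted_leq_nth _ geq _ _ 0 la la_sorted) => //.
- by move=> a b c /= ab bc; apply: leq_trans bc ab.
- by move=> a /=.
- by rewrite inE; apply: leq_ltn_trans jn.
Qed.

Lemma noninc_sorted (la : seq nat) :
  (forall i, nth 0 la i.+1 <= nth 0 la i) -> sorted geq la.
Proof. by move=> la_dec; apply/(sortedP 0) => i _; apply: la_dec. Qed.

(** By monotonicity the rows of length at least [x] form an initial segment, counted by
    [pconj la x]; [0 < x] excludes the default rows past the end. *)
Lemma leq_nth_pconj (la : seq nat) (x k : nat) :
  noninc la -> 0 < x -> (x <= nth 0 la k) = (k < pconj la x).
Proof.
move=> + x_gt0; rewrite /pconj; elim: la k => [|a la IH] k la_dec.
  by rewrite nth_nil /=; lia.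
have la_dec' : noninc la by move=> i j ij; apply: (la_dec i.+1 j.+1).
have zero : a < x -> count (fun p => x <= p) la = 0.
  move=> lt_ax; apply/eqP; rewrite -leqn0 leqNgt -has_count.
  apply/hasPn => b /(nthP 0)[i _ <-].
  by rewrite -ltnNge; have := la_dec 0 i.+1 isT; rewrite /=; lia.
case: k => [|k] /=; rewrite ?IH //.
  by case: (leqP x a) => /= [|/zero->]; rewrite ?addnS.
by case: (leqP x a) => /= [|/zero->]; rewrite ?ltn0 ?add1n ?ltnS ?addn0 ?ltn0.
Qed.

Lemma pconj_eq (la : seq nat) (x k : nat) : noninc la ->
  (nth 0 la k < x) -> (k = 0 \/ (x <= nth 0 la k.-1)) -> pconj la x = k.
Proof.
move=> la_dec lt_x le_x.
have x_gt0 : (0 < x) by lia.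
have := leq_nth_pconj k la_dec x_gt0.
case: le_x => [k0|le_x]; first by subst k; lia.
have := leq_nth_pconj k.-1 la_dec x_gt0; lia.
Qed.

Lemma mem_cells (la : seq nat) (c : nat * nat) :
  (c \in cells la) = [&& 0 < c.1, 0 < c.2 & c.1 <= prow la c.2]%N.
Proof.
case: c => x y /=; apply/flattenP/idP => [[r /mapP[y' y'P ->] /mapP[x' x'P]]|].
  by case=> -> ->; move: x'P y'P; rewrite !mem_iota; lia.
case/and3P => x0 y0 xy; exists [seq (x, y) | x <- iota 1 (prow la y)].
  apply/mapP; exists y => //; rewrite mem_iota y0 /=.
  case: (leqP y (size la)) => // ?; move: xy.
  by rewrite /prow nth_default; lia.
by apply/mapP; exists x => //; rewrite mem_iota; lia.
Qed.

Section BigCells.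
Variables (R : Type) (idx : R) (op : Monoid.com_law idx).

Lemma big_cells (la : seq nat) (n : nat) (F : nat * nat -> R) : (size la <= n) ->
  \big[op/idx]_(c <- cells la) F c =
  \big[op/idx]_(0 <= k < n) \big[op/idx]_(0 <= x < nth 0 la k) F (x.+1, k.+1).
Proof.
move=> le_n; rewrite big_flatten big_map [RHS](big_cat_nat (n := size la)) //=.
rewrite [X in _ = op _ X]big_nat [X in _ = op _ X]big1; last first.
  by move=> k /andP[lek _]; rewrite nth_default // big_geq.
rewrite Monoid.mulm1 -[1%N]/(1 + 0) iotaDl big_map /index_iota subn0.
apply: eq_bigr => k _; rewrite big_map iotaDl big_map subn0 /prow.
by apply: eq_bigr => x _.
Qed.

End BigCells.

(** The zeros of a nonincreasing sequence are trailing, so dropping them is invisible to [nth] with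
    default 0. *)
Lemma nth_filter_gt0 (s : seq nat) (k : nat) :
  noninc s -> nth 0 [seq p <- s | 0 < p] k = nth 0 s k.
Proof.
elim: s k => [//|a s IH] k s_dec.
have s_dec' : noninc s by move=> i j ij; apply: (s_dec i.+1 j.+1).
case: a s_dec => [|a] s_dec; last by case: k => [//|k] /=; apply: IH.
by rewrite /= IH //; have := s_dec 0 k.+1 isT; have := s_dec 0 k isT; rewrite /=; lia.
Qed.

(** * Adding one cell to row [y] *)

Section AddCell.
Variables (ka rho : seq nat) (y : nat).
Hypotheses (ka_dec : noninc ka) (rho_dec : noninc rho).
Hypothesis rhoE : forall k, nth 0 rho k = nth 0 ka k + (k == y).

Let r := nth 0 ka y.

Lemma mem_skew (d : nat * nat) : (d \in Defs.skew rho ka) = (d == (r.+1, y.+1)).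
Proof.
case: d => x [|k]; rewrite mem_filter !mem_cells /prow /= xpair_eqE ?rhoE; first by lia.
by rewrite /r eqSS; case: eqP => [->|]; lia.
Qed.

Lemma has_skew (P : pred (nat * nat)) : has P (Defs.skew rho ka) = P (r.+1, y.+1).
Proof.
apply/hasP/idP => [[d]|Pd]; first by rewrite mem_skew => /eqP ->.
by exists (r.+1, y.+1); rewrite ?mem_skew.
Qed.

(** Since [rho] stays nonincreasing when row [y] grows, every earlier row of [ka] is strictly longer
    than [r]. *)
Lemma ltn_addcell (k : nat) : (r < nth 0 ka k) = (k < y).
Proof.
have [k_lt|y_le] := ltnP k y; last by rewrite ltnNge ka_dec.
by have := rho_dec (ltnW k_lt); rewrite !rhoE eqxx (ltn_eqF k_lt) /r; lia.
Qed.

Lemma pconj_add_row (x : nat) : 0 < x <= r -> pconj rho x = pconj ka x.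
Proof.
case/andP=> x_gt0 x_le; apply/eqP; rewrite eqn_leq.
have E k : (k < pconj rho x) = (k < pconj ka x).
  rewrite -!leq_nth_pconj // rhoE; case: eqP => [->|_]; last by rewrite addn0.
  by rewrite addn1 -/r; lia.
by rewrite leqNgt E ltnn /= leqNgt -E ltnn.
Qed.

Lemma pconj_add_col : pconj ka r.+1 = y /\ pconj rho r.+1 = y.+1.
Proof.
have lt_r k : k < y -> r < nth 0 ka k by rewrite ltn_addcell.
split; apply: pconj_eq => //.
- by case: {+}y lt_r => [|y'] lt_r; [left | right; apply: lt_r].
- by rewrite rhoE gtn_eqF // addn0 ltnS ka_dec.
- by right; rewrite rhoE eqxx addn1.
Qed.

Lemma addcell_leq_size : y <= size ka.
Proof.
rewrite leqNgt; apply/negP => lt_y; have y_gt0 := leq_ltn_trans (leq0n _) lt_y.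
have : r < nth 0 ka y.-1 by rewrite ltn_addcell prednK.
by rewrite (@nth_default _ _ ka y.-1) // -ltnS prednK.
Qed.

Variables (R : Type) (idx : R) (op : Monoid.com_law idx).

Lemma big_Rcells (F : nat * nat -> R) :
  \big[op/idx]_(c <- Rcells rho ka) F c =
  \big[op/idx]_(0 <= x < r) F (x.+1, y.+1).
Proof.
rewrite big_filter; under eq_bigl do rewrite has_skew /=.
(* Row [y] may be the first empty row of [ka]; the bound is enlarged so that the range contains
   it. *)
rewrite big_mkcond (@big_cells _ _ _ _ (maxn (size ka) y.+1)) ?leq_maxl //.
rewrite (bigD1_seq y) ?iota_uniq //=; last by rewrite mem_index_iota; lia.
rewrite eqxx [X in op _ X]big1 ?Monoid.mulm1 // => k ne_ky.
by rewrite big1 // => x _; rewrite eqSS eq_sym (negbTE ne_ky).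
Qed.

Lemma big_Ccells (F : nat * nat -> R) :
  \big[op/idx]_(c <- Ccells rho ka) F c =
  \big[op/idx]_(0 <= k < y) F (r.+1, k.+1).
Proof.
rewrite big_filter; under eq_bigl do rewrite has_skew /=.
rewrite big_mkcond (@big_cells _ _ _ _ (maxn (size ka) y)) ?leq_maxl //.
rewrite (big_cat_nat (n := y)) ?leq_maxr //= [X in op _ X]big1_seq ?Monoid.mulm1.
  apply: eq_big_nat => k /= k_lt; rewrite (bigD1_seq r) ?iota_uniq //=; last first.
    by rewrite mem_index_iota ltn_addcell.
  by rewrite eqxx [X in op _ X]big1 ?Monoid.mulm1 // => x /negbTE; rewrite eqSS eq_sym => ->.
move=> k /=; rewrite mem_index_iota => /andP[y_le _].
apply: big1_seq => x /=; rewrite mem_index_iota eqSS => x_lt.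
by case: eqP => // rx; have := ltn_addcell k; lia.
Qed.

End AddCell.

(** * The statistics [nfun] and [nfun'] *)

Lemma sum_ltn (n k m : nat) :
  \sum_(0 <= j < n) (k <= j) * (j < m) = minn n m - k.
Proof. by elim: n => [|n IH]; rewrite ?big_nil ?big_nat_recr //= ?IH; lia. Qed.

(** The leg of a cell counts the later rows reaching its column; after exchanging sums, each cell of
    row [j] is counted once for every [k < j]. *)
Lemma nfunE (la : seq nat) (n : nat) : noninc la -> size la <= n ->
  nfun la = \sum_(0 <= k < n) k * nth 0 la k.
Proof.
move=> la_dec le_n; rewrite /nfun sumnE big_map (@big_cells _ _ _ _ n) //=.
transitivity (\sum_(0 <= k < n) \sum_(0 <= j < n) (k < j) * nth 0 la j).
  apply: eq_bigr => k _.
  transitivity (\sum_(0 <= x < nth 0 la k)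
     \sum_(0 <= j < n) (k < j) * (x < nth 0 la j)).
    apply: eq_bigr => x _; rewrite /leg /=.
    under eq_bigr do rewrite leq_nth_pconj //.
    by rewrite sum_ltn (minn_idPr _) // (leq_trans (count_size _ _)).
  rewrite exchange_big_nat; apply: eq_bigr => j _ /=; rewrite -big_distrr /=.
  case: ltnP => //= k_lt; rewrite !mul1n.
  have := sum_ltn (nth 0 la k) 0 (nth 0 la j).
  rewrite subn0 (minn_idPr (la_dec _ _ (ltnW k_lt))) => {2}<-.
  by apply: eq_bigr => x _; rewrite mul1n.
rewrite exchange_big_nat; apply: eq_big_nat => j /= j_lt; rewrite -big_distrl /=.
congr (_ * _); have := sum_ltn n 0 j; rewrite subn0 (minn_idPr (ltnW j_lt)) => {2}<-.
by apply: eq_bigr => x _; rewrite mul1n.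
Qed.

Lemma nfun'E (la : seq nat) (n : nat) : size la <= n ->
  nfun' la = \sum_(0 <= k < n) \sum_(0 <= x < nth 0 la k) x.
Proof.
move=> le_n; rewrite /nfun' sumnE big_map (@big_cells _ _ _ _ n) //=.
apply: eq_bigr => k _; rewrite [RHS]big_nat_rev; apply: eq_bigr => x _.
by rewrite /arm /prow /= add0n.
Qed.

Lemma nfun_addcell (ka rho : seq nat) (y : nat) :
  noninc ka -> noninc rho -> (forall k, nth 0 rho k = nth 0 ka k + (k == y)) ->
  nfun rho = nfun ka + y.
Proof.
move=> ka_dec rho_dec rhoE; pose n := maxn y.+1 (maxn (size ka) (size rho)).
rewrite !(@nfunE _ n) //; try by rewrite /n; lia.
under eq_bigr do rewrite rhoE mulnDr.
rewrite big_split /=; congr (_ + _).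
rewrite (bigD1_seq y) ?iota_uniq ?mem_index_iota //=; last by rewrite /n; lia.
by rewrite eqxx muln1 big1 ?addn0 // => k /negbTE ->; rewrite muln0.
Qed.

Lemma nfun'_addcell (ka rho : seq nat) (y : nat) :
  (forall k, nth 0 rho k = nth 0 ka k + (k == y)) ->
  nfun' rho = nfun' ka + nth 0 ka y.
Proof.
move=> rhoE; pose n := maxn y.+1 (maxn (size ka) (size rho)).
rewrite !(@nfun'E _ n) //; try by rewrite /n; lia.
have E k : \sum_(0 <= x < nth 0 rho k) x =
    \sum_(0 <= x < nth 0 ka k) x + (k == y) * nth 0 ka k.
  rewrite rhoE; case: eqP => _; rewrite ?addn0 // addn1 mul1n.
  by rewrite big_nat_recr.
under eq_bigr do rewrite E.
rewrite big_split /=; congr (_ + _).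
rewrite (bigD1_seq y) ?iota_uniq ?mem_index_iota //=; last by rewrite /n; lia.
by rewrite eqxx mul1n big1 ?addn0 // => k /negbTE ->.
Qed.

Lemma remove_cellP (la : seq nat) (i : nat) (s := set_nth 0 la i (nth 0 la i).-1)
    (mu := [seq p <- s | 0 < p]) :
  noninc s -> i < size la -> 0 < nth 0 la i ->
  [/\ noninc mu, forall k, nth 0 la k = nth 0 mu k + (k == i) & size mu <= size la].
Proof.
move=> s_dec i_lt lai_gt0; split.
- by move=> k l kl; rewrite !nth_filter_gt0 //; apply: s_dec.
- move=> k; rewrite nth_filter_gt0 // nth_set_nth /=.
  by case: eqP => [->|_]; [lia | rewrite addn0].
- by rewrite size_filter (leq_trans (count_size _ _)) // size_set_nth (maxn_idPr i_lt).
Qed.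

Local Open Scope ring_scope.

(** * Lagrange interpolation *)

(** Such a [p] equals its Lagrange interpolant; the basis polynomials [L x] are monic of degree
    [size s - 1], and the coefficients of that degree are compared. *)
Lemma lagrange_lead (F : fieldType) (s : seq F) (p : {poly F}) :
  uniq s -> (size p <= size s)%N ->
  \sum_(x <- s) p.[x] / \prod_(y <- s | y != x) (x - y) = p`_(size s).-1.
Proof.
move=> s_uniq sz_p.
pose L x := \prod_(y <- s | y != x) ('X - y%:P).
have sz_L x : x \in s -> size (L x) = size s.
  move=> xs; rewrite /L -big_filter size_prod_XsubC -rem_filter //.
  by rewrite size_rem // prednK // -has_predT; apply/hasP; exists x.
have L_eval x z : (L x).[z] = \prod_(y <- s | y != x) (z - y).
  by rewrite horner_prod; apply: eq_bigr => y _; rewrite hornerXsubC.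
(* The difference of the two sides vanishes at all [size s] nodes and has size at most [size s]. *)
have p_eq : p = \sum_(x <- s) (p.[x] / \prod_(y <- s | y != x) (x - y)) *: L x.
  apply/eqP; rewrite -subr_eq0; apply/eqP.
  apply: (@roots_geq_poly_eq0 _ _ s) => //.
    apply/allP => z zs; rewrite rootE hornerD hornerN horner_sum.
    rewrite (bigD1_seq z) //= hornerZ L_eval divfK; last first.
      rewrite prodf_seq_neq0; apply/allP => y _; apply/implyP => ne_yz.
      by rewrite subr_eq0 eq_sym.
    rewrite big1_seq ?addr0 ?subrr // => x /andP[ne_xz xs].
    rewrite hornerZ L_eval; set P := \prod_(_ <- _ | _) (z - _).
    have -> : P = 0; last by rewrite mulr0.
    apply/eqP; rewrite /P prodf_seq_eq0; apply/hasP; exists z => //=.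
    by rewrite eq_sym ne_xz subrr eqxx.
  rewrite (leq_trans (size_polyD _ _)) // geq_max sz_p size_polyN.
  rewrite big_seq; apply: (leq_trans (size_sum _ _ _)).
  apply/bigmax_leqP_seq => x xs _.
  by rewrite (leq_trans (size_scale_leq _ _)) // sz_L.
rewrite [in RHS]p_eq coef_sum big_seq [RHS]big_seq.
apply: eq_bigr => x xs; rewrite coefZ -(sz_L x xs) -lead_coefE.
have -> : lead_coef (L x) = 1.
  by rewrite /L lead_coef_prod big1 // => y _; rewrite lead_coefXsubC.
by rewrite mulr1.
Qed.

(** The nodes [v i] run over rows; the extra node [w] will be [q * U la m] in the first identity and
    [U la y] in the second. *)
Lemma lagrange_lead_cons (F : fieldType) (N : nat) (v : nat -> F) (w : F)
    (p : {poly F}) :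
  (forall i j, (i < N)%N -> (j < N)%N -> v i = v j -> i = j) ->
  (forall i, (i < N)%N -> v i != w) -> (size p <= N.+1)%N ->
  \sum_(0 <= i < N)
     p.[v i] / ((v i - w) * \prod_(0 <= k < N | k != i) (v i - v k)) =
  p`_N - p.[w] / \prod_(0 <= k < N) (w - v k).
Proof.
move=> v_inj v_w sz_p.
have s_uniq : uniq (w :: [seq v i | i <- index_iota 0 N]).
  rewrite /= map_inj_in_uniq ?iota_uniq ?andbT; last first.
    by move=> i j; rewrite !mem_index_iota => iN jN; apply: v_inj.
  by apply/mapP => -[i]; rewrite mem_index_iota => /v_w vw wv; rewrite wv eqxx in vw.
have := @lagrange_lead F _ p s_uniq; rewrite /= size_map size_iota subn0.
move=> /(_ sz_p) <-; rewrite !big_cons eqxx /= !big_map.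
have -> : \prod_(j <- index_iota 0 N | v j != w) (w - v j) =
          \prod_(0 <= k < N) (w - v k).
  rewrite big_seq_cond [RHS]big_seq; apply: eq_bigl => i.
  by rewrite mem_index_iota /=; case: ltnP => //= /v_w ->.
rewrite addrAC subrr add0r big_seq [RHS]big_seq; apply: eq_bigr => i.
rewrite mem_index_iota /= => iN.
rewrite big_cons eq_sym v_w // big_map; congr (_ / (_ * _)).
rewrite big_seq_cond [RHS]big_seq_cond; apply: eq_bigl => j.
rewrite mem_index_iota /=; case: (ltnP j N) => //= jN.
by congr negb; apply/eqP/eqP => [->|/v_inj ->].
Qed.

(** * Generic parameters: nonzero [q], [t] with pairwise distinct monomials *)

Section FreeParameters.
Variables (F : fieldType) (q t : F).
Hypotheses (q_neq0 : q != 0) (t_neq0 : t != 0).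
Hypothesis monom_inj : forall a b c d : nat,
  q ^+ a * t ^+ b = q ^+ c * t ^+ d -> a = c /\ b = d.

Definition bracket (i j : nat) : F := 1 - q ^+ i * t ^+ j.

Lemma bracket_neq0 (i j : nat) : (0 < i + j)%N -> bracket i j != 0.
Proof.
move=> ij; rewrite /bracket subr_eq0; apply/eqP => E.
have := @monom_inj 0%N 0%N i j; rewrite mulr1 => /(_ E); lia.
Qed.

Definition U (la : seq nat) (k : nat) : F := t ^+ k / q ^+ nth 0%N la k.

Lemma U_neq0 la k : U la k != 0.
Proof. by rewrite mulf_neq0 ?invr_eq0 ?expf_neq0 ?q_neq0 ?t_neq0. Qed.

(** This converts brackets into differences of the weights [U]. *)
Lemma U_div la i j : noninc la -> (i <= j)%N ->
  q ^+ (nth 0%N la i - nth 0%N la j) * t ^+ (j - i) = U la j / U la i.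
Proof.
move=> la_dec ij; have le_ji := la_dec _ _ ij.
apply: (mulIf (U_neq0 la i)); rewrite divfK ?U_neq0 //.
apply: (mulIf (expf_neq0 (nth 0%N la j) q_neq0)); rewrite /U divfK ?expf_neq0 //.
have -> : q ^+ nth 0%N la i = q ^+ (nth 0%N la i - nth 0%N la j) * q ^+ nth 0%N la j.
  by rewrite -exprD subnK.
have -> : t ^+ j = t ^+ (j - i) * t ^+ i by rewrite -exprD subnK.
by field; rewrite !expf_neq0.
Qed.

(** * Product formulas for [alpha] and [alphabar] *)

(** Counted from 0, the columns [x] with [nth 0 la k.+1 <= x < nth 0 la k] all have height [k + 1];
    row [y] is cut into these blocks. *)
Lemma prod_by_column_height (la : seq nat) (n y : nat) (G : nat -> nat -> F) :
  noninc la -> (size la <= n)%N -> (y <= n)%N ->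
  \prod_(0 <= x < nth 0%N la y) G x (pconj la x.+1) =
  \prod_(y <= k < n) \prod_(nth 0%N la k.+1 <= x < nth 0%N la k) G x k.+1.
Proof.
move=> la_dec le_n; move E: (n - y)%N => m; elim: m y E => [|m IH] y E le_yn.
  by rewrite (big_geq (m := y)) ?nth_default ?big_geq //; lia.
rewrite (big_ltn (m := y)); last by lia.
rewrite -IH; try by lia.
rewrite mulrC (big_cat_nat (n := nth 0%N la y.+1)) ?la_dec //=.
congr (_ * _); apply: eq_big_nat => x /andP[x_ge x_lt]; congr (G _ _).
by apply: pconj_eq => //; right.
Qed.

(* [alpha] is [(d, e) = (0, 1)] and [alphabar] is [(d, e) = (1, 0)]. *)
Definition galpha (d e : nat) (rho ka : seq nat) : F :=
  (\prod_(c <- Rcells rho ka)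
     (bracket (arm ka c + d) (leg ka c + e) / bracket (arm rho c + d) (leg rho c + e))) *
  (\prod_(c <- Ccells rho ka)
     (bracket (arm ka c + e) (leg ka c + d) / bracket (arm rho c + e) (leg rho c + d))).

(** On a block of columns of equal height the leg is constant and the arm drops by one at each step,
    so the quotients telescope. *)
Lemma row_telescope (la : seq nat) (n y d e : nat) (r := nth 0%N la y) :
  noninc la -> (size la <= n)%N -> (y <= n)%N -> (d + e = 1)%N ->
  \prod_(0 <= x < r)
     (bracket (r - x.+1 + d) (pconj la x.+1 - y.+1 + e) /
      bracket (r - x + d) (pconj la x.+1 - y.+1 + e)) =
  \prod_(y <= k < n)
     (bracket (r - nth 0%N la k + d) (k - y + e) / bracket (r - nth 0%N la k.+1 + d) (k - y + e)).
Proof.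
move=> la_dec le_n le_yn de.
pose G x h := bracket (r - x.+1 + d) (h - y.+1 + e) / bracket (r - x + d) (h - y.+1 + e).
rewrite (@prod_by_column_height la n y G) //; apply: eq_big_nat => k /andP[yk kn].
have le_r : (nth 0%N la k <= r)%N by apply: la_dec.
pose f x := bracket (r - x + d) (k - y + e).
have f_neq0 x : f x != 0 by apply: bracket_neq0; lia.
(* Equal consecutive rows give an empty block, matched by a quotient of equal brackets. *)
have := la_dec k k.+1 (leqnSn k); rewrite leq_eqVlt => /orP[/eqP ->|lt_k].
  by rewrite big_geq // divff // f_neq0.
by rewrite -[RHS]/(f _ / f _) -telescope_prodf.
Qed.

(** Each bracket is a difference of weights divided by [U ka y]. A denominator pairs row [k + 1]
    with the distance [k - y], one too small, hence [s / t] and the shifted range. *)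
Lemma galpha_row (ka : seq nat) (n y d e : nat) (s := q ^+ d * t ^+ e) :
  noninc ka -> (size ka <= n)%N -> (y <= n)%N -> (d + e = 1)%N ->
  \prod_(y <= k < n)
     (bracket (nth 0%N ka y - nth 0%N ka k + d) (k - y + e) /
      bracket (nth 0%N ka y - nth 0%N ka k.+1 + d) (k - y + e)) =
  \prod_(y <= k < n) (U ka y - s * U ka k) /
  \prod_(y.+1 <= k < n.+1) (U ka y - s / t * U ka k).
Proof.
move=> ka_dec le_n le_yn de; rewrite big_add1 /= -prodfV -big_split /=.
apply: eq_big_nat => k /andP[yk kn].
have b0 : bracket (nth 0%N ka y - nth 0%N ka k.+1 + d) (k - y + e) != 0.
  by apply: bracket_neq0; lia.
have E1 : bracket (nth 0%N ka y - nth 0%N ka k + d) (k - y + e) =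
    1 - s * (U ka k / U ka y).
  by rewrite /bracket -(U_div ka_dec yk) !exprD /s; ring.
have E2 : bracket (nth 0%N ka y - nth 0%N ka k.+1 + d) (k - y + e) =
    1 - s / t * (U ka k.+1 / U ka y).
  rewrite /bracket -(U_div ka_dec (leqW yk)) subSn // !exprD exprS /s; field.
  exact: t_neq0.
move: b0; rewrite E1 E2 => b0; rewrite -(mulfK (U_neq0 ka y) (1 - s * _)).
rewrite -mulrA -invfM; congr (_ / _); field; rewrite ?U_neq0 ?t_neq0 //.
Qed.

(** As [d + e = 1], with [u = U ka y] and [v = U ka k] the brackets are [1 - u / (s * v)] and
    [1 - t * u / (s * v)]. Turning their quotient into one of differences costs a factor [t] for
    each [k], supplied by [t ^+ y]. *)
Lemma galpha_col (ka : seq nat) (y d e : nat) (s := q ^+ d * t ^+ e) :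
  noninc ka -> (d + e = 1)%N -> (forall k, (k < y)%N -> nth 0%N ka y < nth 0%N ka k)%N ->
  t ^+ y * \prod_(0 <= k < y)
     (bracket (nth 0%N ka k - (nth 0%N ka y).+1 + e) (y - k.+1 + d) /
      bracket (nth 0%N ka k - (nth 0%N ka y).+1 + e) (y - k + d)) =
  \prod_(0 <= k < y) (U ka y - s * U ka k) /
  \prod_(0 <= k < y) (U ka y - s / t * U ka k).
Proof.
move=> ka_dec de lt_y.
have -> : t ^+ y = \prod_(0 <= k < y) t by rewrite prodr_const_nat subn0.
rewrite -prodfV -!big_split /=.
apply: eq_big_nat => k /andP[_ ky].
have : bracket (nth 0%N ka k - (nth 0%N ka y).+1 + e) (y - k + d) != 0.
  by apply: bracket_neq0; lia.
have s0 : s != 0 by rewrite mulf_neq0 ?expf_neq0.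
have de' : d = 0%N /\ e = 1%N \/ d = 1%N /\ e = 0%N by lia.
move: (U_div ka_dec (ltnW ky)); rewrite -(subnSK ky) -(subnSK (lt_y k ky)).
set a := (nth 0%N ka k - _)%N; set b := (y - k.+1)%N.
rewrite -(addn1 a) -(addn1 b) => E b0.
have E1 : bracket (a + e) (b + d) = 1 - U ka y / U ka k / s.
  rewrite /bracket -E; congr (1 - _); apply: (mulIf s0); rewrite divfK //.
  by rewrite /s; case: de' => -[-> ->]; rewrite !exprD; ring.
have E2 : bracket (a + e) (b + 1 + d) = 1 - t * (U ka y / U ka k / s).
  rewrite /bracket -E; congr (1 - _); apply: (mulIf s0); rewrite -[RHS]mulrA divfK //.
  by rewrite /s; case: de' => -[-> ->]; rewrite !exprD; ring.
rewrite E2 in b0; rewrite E1 E2 {E E1 E2}.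
have [Uy Uk] := (U_neq0 ka y, U_neq0 ka k).
move: b0 s0 t_neq0 Uy Uk; move: (U ka y) (U ka k) (s) (t) => u v c z b0 c0 z0 u0 v0.
have b1 : v * c - z * u != 0.
  apply: contraNneq b0 => b1; have -> : 1 - z * (u / v / c) = (v * c - z * u) / (v * c).
    by field; rewrite c0 v0.
  by rewrite b1 mul0r.
have b2 : u * z - c * v != 0 by rewrite -oppr_eq0 opprB mulrC [u * z]mulrC.
by field; rewrite z0 c0 v0 b1 b2.
Qed.

(** The column part covers the rows [k < y], the row part those with [k >= y]; the denominators of
    the latter start at [y + 1], which leaves the gap at [k = y]. *)
Lemma galphaE (ka rho : seq nat) (n y d e : nat) (s := q ^+ d * t ^+ e) :
  noninc ka -> noninc rho -> (forall k, nth 0%N rho k = nth 0%N ka k + (k == y))%N ->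
  (size ka <= n)%N -> (y <= n)%N -> (d + e = 1)%N ->
  t ^+ y * galpha d e rho ka =
  \prod_(0 <= k < n) (U ka y - s * U ka k) /
  \prod_(0 <= k < n.+1 | k != y) (U ka y - s / t * U ka k).
Proof.
move=> ka_dec rho_dec rhoE le_n le_yn de.
have lt_y k : (k < y)%N -> (nth 0%N ka y < nth 0%N ka k)%N.
  by rewrite (ltn_addcell ka_dec rho_dec rhoE).
have [pka prho] := pconj_add_col ka_dec rho_dec rhoE.
rewrite /galpha (big_Rcells rhoE) (big_Ccells ka_dec rho_dec rhoE).
have -> : \prod_(0 <= x < nth 0%N ka y)
     (bracket (arm ka (x.+1, y.+1) + d) (leg ka (x.+1, y.+1) + e) /
      bracket (arm rho (x.+1, y.+1) + d) (leg rho (x.+1, y.+1) + e)) =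
   \prod_(y <= k < n) (U ka y - s * U ka k) /
   \prod_(y.+1 <= k < n.+1) (U ka y - s / t * U ka k).
  rewrite -galpha_row // -(row_telescope ka_dec le_n le_yn de).
  apply: eq_big_nat => x /andP[_ x_lt]; rewrite /arm /leg /prow /= rhoE eqxx.
  by rewrite (pconj_add_row ka_dec rho_dec rhoE) // addn1 subSS.
have -> : \prod_(0 <= k < y)
     (bracket (arm ka ((nth 0%N ka y).+1, k.+1) + e)
              (leg ka ((nth 0%N ka y).+1, k.+1) + d) /
      bracket (arm rho ((nth 0%N ka y).+1, k.+1) + e)
              (leg rho ((nth 0%N ka y).+1, k.+1) + d)) =
   \prod_(0 <= k < y)
     (bracket (nth 0%N ka k - (nth 0%N ka y).+1 + e) (y - k.+1 + d) /
      bracket (nth 0%N ka k - (nth 0%N ka y).+1 + e) (y - k + d)).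
  apply: eq_big_nat => k /andP[_ k_lt]; rewrite /arm /leg /prow /= rhoE.
  by rewrite ltn_eqF // addn0 pka prho subSS.
rewrite mulrCA galpha_col // (big_cat_nat (m := 0%N) (n := y) (p := n)) //=.
rewrite (big_cat_nat (m := 0%N) (n := y) (p := n.+1)) ?leqW //=.
rewrite (big_ltn_cond (m := y) (n := n.+1)) // eqxx /=.
rewrite mulf_div; congr (_ / _); rewrite mulrC //.
congr (_ * _); rewrite big_nat [RHS]big_nat_cond; apply: eq_bigl => k;
  by case: ltngtP; rewrite ?andbF ?andbT.
Qed.

(** * Nonvanishing of differences of weights *)

Lemma U_monom_inj (la : seq nat) (i j a b c d : nat) :
  q ^+ a * t ^+ b * U la i = q ^+ c * t ^+ d * U la j ->
  (a + nth 0 la j = c + nth 0 la i /\ b + i = d + j)%N.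
Proof.
have [qi qj] := (expf_neq0 (nth 0%N la i) q_neq0, expf_neq0 (nth 0%N la j) q_neq0).
move=> E; apply: monom_inj; rewrite !exprD.
transitivity (q ^+ a * t ^+ b * U la i * (q ^+ nth 0%N la i * q ^+ nth 0%N la j)).
  by rewrite /U; field.
by rewrite E /U; field.
Qed.

Lemma U_inj (la : seq nat) (i j : nat) : U la i = U la j -> i = j.
Proof. by move=> E; have [] := @U_monom_inj la i j 0 0 0 0; rewrite ?E ?add0n. Qed.

Lemma sub1q_neq0 : 1 - q != 0.
Proof.
by rewrite subr_eq0; apply/eqP=> E; have [] := @monom_inj 1%N 0%N 0%N 0%N; rewrite ?mulr1.
Qed.

Lemma sub1t_neq0 : 1 - t != 0.
Proof.
by rewrite subr_eq0; apply/eqP=> E; have [] := @monom_inj 0%N 1%N 0%N 0%N; rewrite ?mul1r.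
Qed.

Lemma U_neq_qU (la : seq nat) (i m : nat) : U la i != q * U la m.
Proof.
apply/eqP => E; have [] := @U_monom_inj la i m 0 0 1 0; first by rewrite !mul1r mulr1.
by rewrite !add0n => lE im; move: lE; rewrite im; lia.
Qed.

Lemma U_sub_neq0 (la : seq nat) (i j : nat) : i != j -> U la i - U la j != 0.
Proof.
move=> ij; rewrite subr_eq0; apply: contra_neq ij => E.
exact: U_inj E.
Qed.

(** Equality would force [m = k + 1] with row [m] one cell longer than row [k]. *)
Lemma qU_sub_tU_neq0 (la : seq nat) (m k : nat) :
  noninc la -> k != m -> q * U la m - t * U la k != 0.
Proof.
move=> la_dec km; rewrite subr_eq0; apply/eqP => E.
have [] := @U_monom_inj la m k 1 0 0 1; first by rewrite expr0 expr1 mulr1 mul1r.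
move=> lE; rewrite add0n => mE; have := la_dec k k.+1 (leqnSn k).
by rewrite -add1n -mE; lia.
Qed.

Lemma big_nat_prod_neq0 (N : nat) (P : pred nat) (G : nat -> F) :
  (forall k, P k -> G k != 0) -> \prod_(0 <= k < N | P k) G k != 0.
Proof. by move=> G0; rewrite prodf_seq_neq0; apply/allP => k _; apply/implyP/G0. Qed.

Lemma expzB (x : F) (a b : nat) : x != 0 -> x ^ (a%:Z - b%:Z) = x ^+ a / x ^+ b.
Proof. by move=> x0; rewrite expfzDr // -invr_expz. Qed.

(** * Transition weights as interpolation terms *)

(** Common form of [Pdown], at [(d, e) = (0, 1)], and of [Pbar] off the diagonal, at [(1, 0)]; the
    final divisor is [gamma]. *)
Definition weight (d e : nat) (la mu nu : seq nat) : F :=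
  t ^ (Bexp la mu nu - 1) * (galpha d e nu la * (galpha d e la mu)^-1) /
  ((1 - q ^ Aexp la mu nu * t ^ Bexp la mu nu) *
   (1 - q ^ (Aexp la mu nu + 1) * t ^ (Bexp la mu nu - 1)) / ((1 - q) * (1 - t))).

Section Weights.
Variables (la mu : seq nat) (m : nat).
Hypotheses (la_dec : noninc la) (mu_dec : noninc mu).
Hypothesis laE : forall k, nth 0%N la k = (nth 0%N mu k + (k == m))%N.
Let n := size la.
Let W := q * U la m.

Lemma ltn_removed_row : (nth 0 la m.+1 < nth 0 la m)%N.
Proof. by rewrite !laE eqxx gtn_eqF // addn0 addn1 ltnS mu_dec. Qed.

Lemma removed_row_ltn_size : (m < n)%N.
Proof.
by rewrite ltnNge; apply/negP => le_nm; have := ltn_removed_row; rewrite (nth_default _ le_nm).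
Qed.

Lemma U_mu k : U mu k = (if k == m then q else 1) * U la k.
Proof.
rewrite /U laE; case: eqP => _; rewrite ?addn0 ?mul1r // addn1 exprS.
by field; rewrite expf_neq0.
Qed.

(** Equality would force [y = m + 1] and rows [m], [m + 1] of equal length, but row [m] has a
    removable cell. *)
Lemma U_sub_tU_neq0 (y : nat) : U la y - t * U la m != 0.
Proof.
rewrite subr_eq0; apply/eqP => E.
have [] := @U_monom_inj la y m 0 0 0 1; first by rewrite !mul1r.
rewrite !add0n add1n => lE yE; have := ltn_removed_row; rewrite -yE lE; lia.
Qed.

Hypothesis size_mu : (size mu <= n)%N.

(** This is [galphaE] for [mu], whose only changed weight is [U mu m = W]; the numerator factor at
    [k = m] is [W * (1 - s)]. *)
Lemma galpha_down (d e : nat) (s := q ^+ d * t ^+ e) : (d + e = 1)%N ->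
  t ^+ m * galpha d e la mu =
  W * (1 - s) * \prod_(0 <= k < n | k != m) (W - s * U la k) /
  \prod_(0 <= k < n.+1 | k != m) (W - s / t * U la k).
Proof.
move=> de; rewrite (galphaE mu_dec la_dec laE size_mu (ltnW removed_row_ltn_size) de) -/s.
rewrite (bigD1_seq m) ?iota_uniq ?mem_index_iota ?removed_row_ltn_size //=.
rewrite !U_mu eqxx -/W; congr (_ * _ / _).
- by ring.
- by apply: eq_bigr => k /negbTE km; rewrite U_mu km mul1r.
- by apply: eq_bigr => k /negbTE km; rewrite U_mu km mul1r.
Qed.

Variables (nu : seq nat) (y : nat).
Hypotheses (nu_dec : noninc nu).
Hypothesis nuE : forall k, nth 0%N nu k = (nth 0%N la k + (k == y))%N.

(** With [A] and [B] the exponents in [gamma], [B = y - m] and [q ^ A * t ^ B = U la y / W]; the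
    prefactor [t ^ (B - 1)] is shared out as [galphaE] and [galpha_down] require. *)
Lemma weightE (d e : nat) :
  weight d e la mu nu =
  t ^+ y * galpha d e nu la / (t ^+ m * galpha d e la mu) / t /
  ((1 - U la y / W) * (1 - q / t * (U la y / W)) / ((1 - q) * (1 - t))).
Proof.
rewrite /weight /Aexp /Bexp /nskew /nskew'.
rewrite (nfun_addcell la_dec nu_dec nuE) (nfun_addcell mu_dec la_dec laE).
rewrite (nfun'_addcell nuE) (nfun'_addcell laE).
have E (a b : nat) : Posz (a + b) - Posz a = Posz b by rewrite PoszD addrAC subrr add0r.
rewrite !{}E.
have Wy : q ^ (Posz (nth 0%N mu m) - Posz (nth 0%N la y)) * t ^ (Posz y - Posz m) =
    U la y / W.
  rewrite !expzB // /W /U (laE m) eqxx addn1 exprS; field.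
  by rewrite !expf_neq0 ?q_neq0 ?t_neq0.
rewrite !(expfzDr _ 1) // expr1z Wy !(expfzDr _ (- 1)) //.
have -> : t ^ (-1) = t^-1 by rewrite -invr_expz.
rewrite [_ * q * _]mulrACA Wy expzB //.
by rewrite [(t ^+ m * _)^-1]invfM; congr (_ / (_ * (1 - _) / _)); ring.
Qed.

(** The first factor is free of [y]; the second is the interpolation term at the node [U la y], with
    extra node [W]. *)
Lemma weight_t : weight 0 1 la mu nu =
  - (\prod_(0 <= k < n.+1) (W - U la k) / \prod_(0 <= k < n | k != m) (W - t * U la k)) *
  (\prod_(0 <= k < n | k != m) (U la y - t * U la k) /
   ((U la y - W) * \prod_(0 <= k < n.+1 | k != y) (U la y - U la k))).
Proof.
have le_yn := addcell_leq_size la_dec nu_dec nuE.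
rewrite weightE galpha_down // (galphaE la_dec nu_dec nuE (leqnn _) le_yn) //.
rewrite expr0 expr1 mul1r divff //.
have mul1U N P x : \prod_(0 <= k < N | P k) (x - 1 * U la k) =
    \prod_(0 <= k < N | P k) (x - U la k) by apply: eq_bigr => k _; rewrite mul1r.
rewrite !mul1U.
(* The factor [U la y - t * U la m] split off here cancels the second factor of [gamma];
   [W - U la m], split off next, accounts for [1 - q]. *)
rewrite (bigD1_seq (r := index_iota 0 n) m) ?iota_uniq ?mem_index_iota ?removed_row_ltn_size //=.
rewrite [\prod_(0 <= k < n.+1) (W - U la k)](bigD1_seq m) ?iota_uniq //=; last first.
  rewrite mem_index_iota.
  exact: ltnW removed_row_ltn_size.
have Pd0 : \prod_(0 <= k < n.+1 | k != y) (U la y - U la k) != 0.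
  by apply: big_nat_prod_neq0 => k ky; rewrite U_sub_neq0 // eq_sym.
have Qn0 := big_nat_prod_neq0 n (fun k (km : k != m) => qU_sub_tU_neq0 la_dec km).
have Qd0' : \prod_(0 <= k < n.+1 | k != m) (W - U la k) != 0.
  by apply: big_nat_prod_neq0 => k _; rewrite subr_eq0 eq_sym U_neq_qU.
have Um0 := U_neq0 la m; have Uy0 := U_neq0 la y.
have yW : U la y - q * U la m != 0 by rewrite subr_eq0 U_neq_qU.
have Wy : q * U la m - U la y != 0 by rewrite subr_eq0 eq_sym U_neq_qU.
have tm : t * U la m - U la y != 0 by rewrite -opprB oppr_eq0 U_sub_tU_neq0.
move: Pd0 Qn0 Qd0'; rewrite -/n /W.
move: (\prod_(0 <= k < n | _) (U la y - t * _)) => Pn.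
move: (\prod_(0 <= k < n.+1 | _) (U la y - _)) => Pd.
move: (\prod_(0 <= k < n | _) _) => Qn.
move: (\prod_(0 <= k < n.+1 | _) _) => Qd Pd0 Qn0 Qd0.
have [q1 t1] := (sub1q_neq0, sub1t_neq0).
by field; rewrite Pd0 yW Qn0 t1 q1 Um0 q_neq0 t_neq0 tm Wy Qd0.
Qed.

(** The roles are exchanged: the first factor is free of [m], and the second is the interpolation
    term at the node [W], with extra node [U la y]. *)
Lemma weight_q : weight 1 0 la mu nu =
  - (\prod_(0 <= k < n) (U la y - q * U la k) /
     \prod_(0 <= k < n.+1 | k != y) (U la y - q / t * U la k)) *
  (\prod_(0 <= k < n.+1 | k != y) (W - q / t * U la k) /
   ((W - U la y) * \prod_(0 <= k < n | k != m) (W - q * U la k))).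
Proof.
have le_yn := addcell_leq_size la_dec nu_dec nuE.
rewrite weightE galpha_down // (galphaE la_dec nu_dec nuE (leqnn _) le_yn) //.
rewrite expr0 expr1 mulr1 -/n.
have Um0 := U_neq0 la m; have Uy0 := U_neq0 la y.
have yW : U la y - q * U la m != 0 by rewrite subr_eq0 U_neq_qU.
have Wy : q * U la m - U la y != 0 by rewrite subr_eq0 eq_sym U_neq_qU.
have tm : t * U la m - U la y != 0 by rewrite -opprB oppr_eq0 U_sub_tU_neq0.
have [q1 t1] := (sub1q_neq0, sub1t_neq0).
(* The denominator from [galpha_down] omits [k = m], the interpolated polynomial omits [k = y]; both
   are compared with the full product. *)
have D0 : \prod_(0 <= k < n.+1 | k != m) (W - q / t * U la k) =
    - \prod_(0 <= k < n.+1 | k != y) (W - q / t * U la k) *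
    (t * U la m - U la y) / ((1 - t) * U la m).
  have E : \prod_(0 <= k < n.+1) (W - q / t * U la k) =
      \prod_(0 <= k < n.+1 | k != m) (W - q / t * U la k) * (W - q / t * U la m).
    rewrite (bigD1_seq m) ?iota_uniq ?mem_index_iota //= 1?mulrC //.
    exact: ltnW removed_row_ltn_size.
  rewrite (bigD1_seq y) ?iota_uniq ?mem_index_iota ?ltnS //= in E.
  have m0 : W - q / t * U la m != 0.
    have -> : W - q / t * U la m = - (q * (1 - t) * U la m / t) by rewrite /W; field.
    by rewrite oppr_eq0 mulf_neq0 ?invr_eq0 // mulf_neq0 // mulf_neq0.
  apply: (mulIf m0); rewrite -E /W; field.
  by rewrite Um0 t1 t_neq0.
have Pd0 : \prod_(0 <= k < n.+1 | k != y) (U la y - q / t * U la k) != 0.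
  apply: big_nat_prod_neq0 => k ky; rewrite subr_eq0; apply/eqP => E.
  have [] := @U_monom_inj la y k 0 1 1 0; first by rewrite expr1 !expr0 mul1r mulr1 E; field.
  rewrite add0n => lE yE; have := la_dec (leqnSn y); rewrite -[y.+1]add1n yE add0n lE; lia.
have Qn0 : \prod_(0 <= k < n | k != m) (W - q * U la k) != 0.
  apply: big_nat_prod_neq0 => k km; rewrite /W -mulrBr mulf_neq0 // U_sub_neq0 //.
  by rewrite eq_sym.
(* A zero factor would need [k = m + 1] and equal rows, against the removable cell in row [m]. *)
have Qd0 : \prod_(0 <= k < n.+1 | k != y) (W - q / t * U la k) != 0.
  apply: big_nat_prod_neq0 => k _; rewrite subr_eq0; apply/eqP => E.
  have [] := @U_monom_inj la m k 0 1 0 0.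
    by rewrite expr0 expr1 !mul1r; apply: (mulfI q_neq0); rewrite mulrCA -/W E; field.
  by rewrite !add0n add1n => lE kE; have := ltn_removed_row; rewrite kE lE ltnn.
rewrite D0; move: Pd0 Qn0 Qd0; rewrite /W.
move: (\prod_(0 <= k < n) _) => Pn.
move: (\prod_(0 <= k < n.+1 | _) (U la y - _)) => Pd.
move: (\prod_(0 <= k < n | _) _) => Qn.
move: (\prod_(0 <= k < n.+1 | _) _) => Qd Pd0 Qn0 Qd0.
by field; rewrite Qn0 Wy Pd0 t1 q1 Um0 q_neq0 t_neq0 tm oppr_eq0 Qd0.
Qed.

End Weights.

(** * The two sums for generic parameters *)

Lemma size_big_prodXsubC (n : nat) (P : pred nat) (v : nat -> F) :
  (size (\prod_(0 <= k < n | P k) ('X - (v k)%:P))%R <= n.+1)%N.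
Proof.
rewrite -big_filter size_prod_XsubC ltnS.
by rewrite size_filter (leq_trans (count_size _ _)) // size_iota subn0.
Qed.

Lemma sum_weight_t (la mu : seq nat) (m : nat) :
  noninc la -> noninc mu ->
  (forall k, nth 0%N la k = (nth 0%N mu k + (k == m))%N) -> (size mu <= size la)%N ->
  \sum_(nu <- Uset la) weight 0 1 la mu nu = 1.
Proof.
move=> la_dec mu_dec laE size_mu; set n := size la; pose W := q * U la m.
pose p := \prod_(0 <= k < n | k != m) ('X - (t * U la k)%:P).
have p_eval x : p.[x] = \prod_(0 <= k < n | k != m) (x - t * U la k).
  by rewrite horner_prod; apply: eq_bigr => k _; rewrite hornerXsubC.
have size_p : (size p <= n.+1)%N by apply: size_big_prodXsubC.
pose C := - (\prod_(0 <= k < n.+1) (W - U la k) / p.[W]).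
transitivity (\sum_(0 <= i < n.+1)
   C * (p.[U la i] / ((U la i - W) * \prod_(0 <= k < n.+1 | k != i) (U la i - U la k)))).
  rewrite /Uset -[iota 0 _]/(index_iota 0 n.+1) big_filter big_map [LHS]big_mkcond.
  apply: eq_big_nat => i /andP[_ le_in].
  have nuE k : nth 0%N (incr_nth la i) k = (nth 0%N la k + (k == i))%N.
    by rewrite nth_incr_nth addnC eq_sym.
  case: ifPn => [/sorted_noninc nu_dec|nu_dec].
    by rewrite (weight_t la_dec mu_dec laE size_mu nu_dec nuE) /C !p_eval.
  (* Row [i] is not addable, so it equals the row before it and [U la i = t * U la i.-1]. The factor
     of [p] at [i.-1] is present because row [m] is removable, hence [i.-1 != m]. *)
  suff -> : p.[U la i] = 0 by rewrite mul0r mulr0.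
  (* Row 0 always accepts a cell. *)
  case: i nuE nu_dec le_in => [|i] nuE nu_dec le_in.
    case/negP: nu_dec; apply: noninc_sorted => k; rewrite !nuE.
    by have := la_dec k k.+1 (leqnSn k); lia.
  have lai : nth 0%N la i.+1 = nth 0%N la i.
    apply/eqP; apply: contraNT nu_dec => ne; apply: noninc_sorted => k; rewrite !nuE.
    have := la_dec k k.+1 (leqnSn k); have := la_dec i i.+1 (leqnSn i).
    by move: ne; case: (k =P i) => [->|ki]; lia.
  have im : i != m.
    by apply/eqP => im; have := ltn_removed_row mu_dec laE; rewrite -im lai ltnn.
  rewrite p_eval; apply/eqP; rewrite prodf_seq_eq0; apply/hasP; exists i.
    by rewrite mem_index_iota.
  by rewrite /= im /U lai exprS mulrA subrr eqxx.
rewrite -big_distrr /= lagrange_lead_cons //; last exact: leqW.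
(* There are [n + 2] nodes and [p] has size at most [n + 1], so the coefficient is 0; the remaining
   term at [W] is the inverse of [C]. *)
- rewrite nth_default // sub0r /C mulrNN mulrA divfK ?divff //.
    by apply: big_nat_prod_neq0 => k _; rewrite subr_eq0 eq_sym U_neq_qU.
  by rewrite p_eval; apply: big_nat_prod_neq0 => k km; apply: qU_sub_tU_neq0.
- by move=> i j _ _; apply: U_inj.
- by move=> i _; apply: U_neq_qU.
Qed.

Lemma sum_weight_q (la nu : seq nat) (y : nat) :
  noninc la -> all (fun p => 0 < p)%N la -> noninc nu ->
  (forall k, nth 0%N nu k = (nth 0%N la k + (k == y))%N) ->
  t ^+ y * galpha 1 0 nu la + \sum_(mu <- Dset la) weight 1 0 la mu nu = 1.
Proof.
move=> la_dec la_pos nu_dec nuE; set n := size la.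
have le_yn : (y <= n)%N by exact: addcell_leq_size la_dec nu_dec nuE.
pose p := \prod_(0 <= k < n.+1 | k != y) ('X - (q / t * U la k)%:P).
have p_eval x : p.[x] = \prod_(0 <= k < n.+1 | k != y) (x - q / t * U la k).
  by rewrite horner_prod; apply: eq_bigr => k _; rewrite hornerXsubC.
have size_p : size p = n.+1.
  rewrite /p -big_filter size_prod_XsubC -rem_filter ?iota_uniq //.
  by rewrite size_rem ?size_iota ?subn0 // mem_index_iota ltnS.
(* With [n + 1] nodes and [n] factors in [p], the coefficient extracted is the leading one. *)
have lead_p : p`_n = 1.
  have -> : n = (size p).-1 by rewrite size_p.
  by apply/eqP; rewrite -lead_coefE -monicE; apply: monic_prod_XsubC.
pose X := \prod_(0 <= k < n) (U la y - q * U la k).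
have la_posE i : (i < n)%N -> (0 < nth 0%N la i)%N.
  by move=> ?; apply: (all_nthP 0%N la_pos).
have X0 : X != 0 by apply: big_nat_prod_neq0 => k _; rewrite subr_eq0 U_neq_qU.
rewrite (galphaE la_dec nu_dec nuE (leqnn _) le_yn) // expr0 expr1 mulr1 -/n -/X -p_eval.
have py0 : p.[U la y] != 0.
  rewrite p_eval; apply: big_nat_prod_neq0 => k ky; rewrite subr_eq0; apply/eqP => E.
  have [] := @U_monom_inj la y k 0 1 1 0; first by rewrite expr1 !expr0 mul1r mulr1 E; field.
  by rewrite add0n => lE yE; have := la_dec _ _ (leqnSn y);
    rewrite -[y.+1]add1n yE add0n lE; lia.
have -> : \sum_(mu <- Dset la) weight 1 0 la mu nu =
  \sum_(0 <= i < n) - (X / p.[U la y]) *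
   (p.[q * U la i] / ((q * U la i - U la y) *
      \prod_(0 <= k < n | k != i) (q * U la i - q * U la k))).
  rewrite /Dset -[size la](subn0 n) -/(index_iota 0 n) big_map big_filter big_map.
  rewrite [LHS]big_mkcond.
  apply: eq_big_nat => i /andP[_ i_lt].
  set s := set_nth _ _ _ _.
  have laE k : nth 0%N la k = (nth 0%N s k + (k == i))%N.
    rewrite nth_set_nth /=; case: eqP => [->|_]; last by rewrite addn0.
    by have := la_posE i i_lt; lia.
  case: ifPn => [/sorted_noninc s_dec|s_dec].
    have [mu_dec muE size_mu] := remove_cellP s_dec i_lt (la_posE i i_lt).
    by rewrite (weight_q la_dec mu_dec muE size_mu nu_dec nuE) -!p_eval.
  (* Row [i] is not removable, so row [i.+1] has the same length and
     [q * U la i = q / t * U la i.+1]. This root belongs to [p] because row [i.+1] is not addable,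
     hence differs from [y]. *)
  suff -> : p.[q * U la i] = 0 by rewrite mul0r mulr0.
  have lai : nth 0%N la i.+1 = nth 0%N la i.
    apply/eqP; apply: contraNT s_dec => ne; apply: noninc_sorted => k.
    have := la_dec k k.+1 (leqnSn k); have := la_dec i i.+1 (leqnSn i).
    have := laE k; have := laE k.+1; move: ne; case: (k =P i) => [->|ki]; lia.
  have iy : i.+1 != y.
    apply/eqP => iy; have := nu_dec i i.+1 (leqnSn i).
    by rewrite !nuE lai iy eqxx ltn_eqF -?iy //; lia.
  rewrite p_eval; apply/eqP; rewrite prodf_seq_eq0; apply/hasP; exists i.+1.
    by rewrite mem_index_iota.
  rewrite /= iy /U lai exprS subr_eq0; apply/eqP.
  by field; rewrite expf_neq0.
rewrite -big_distrr /= lagrange_lead_cons ?size_p //.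
(* Multiplying [1 - p.[U la y] / X] by [- (X / p.[U la y])] leaves 1 minus the diagonal term. *)
- rewrite lead_p -/X mulNr mulrBr mulr1 opprB addrC.
  by rewrite mulrA divfK // divff // subrK.
- by move=> i j _ _ /(mulfI q_neq0); apply: U_inj.
- by move=> i _; rewrite eq_sym U_neq_qU.
Qed.

End FreeParameters.

(** * Specialisation to [qv] and [tv] *)

(** In the polynomial ring, the size in the outer variable gives [b = d]; after cancelling ['X^d],
    the size in the inner one gives [a = c]. *)
Lemma qt_monom_inj (a b c d : nat) :
  qv ^+ a * tv ^+ b = qv ^+ c * tv ^+ d -> a = c /\ b = d.
Proof.
rewrite /qv /tv -!rmorphXn -!rmorphM => /eqP; rewrite tofrac_eq => /eqP E.
have X_size i j : size (('X^i : {poly rat})%:P * 'X^j) = j.+1.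
  by rewrite size_Cmul ?size_polyXn // expf_neq0 // polyX_eq0.
have bd : b = d.
  by have := congr1 (fun p : {poly {poly rat}} => size p) E; rewrite !X_size => -[].
split=> //; move: E; rewrite bd => /mulIf.
have Xd : ('X^d : {poly {poly rat}}) != 0 by rewrite expf_neq0 // polyX_eq0.
move=> /(_ Xd) /polyC_inj E.
by have := congr1 (fun p : {poly rat} => size p) E; rewrite !size_polyXn => -[].
Qed.

Lemma qv_neq0 : qv != 0.
Proof. by rewrite /qv tofrac_eq0 polyC_eq0 polyX_eq0. Qed.

Lemma tv_neq0 : tv != 0.
Proof. by rewrite /tv tofrac_eq0 polyX_eq0. Qed.

Lemma alphaE (rho ka : seq nat) : alpha rho ka = galpha qv tv 0 1 rho ka.
Proof. by congr (_ * _); apply: eq_bigr => c _; rewrite !addn0 !addn1. Qed.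

Lemma alphabarE (rho ka : seq nat) : alphabar rho ka = galpha qv tv 1 0 rho ka.
Proof. by congr (_ * _); apply: eq_bigr => c _; rewrite !addn0 !addn1. Qed.

Lemma PdownE (la mu nu : seq nat) : Pdown la mu nu = weight qv tv 0 1 la mu nu.
Proof. by rewrite /Pdown /beta !alphaE. Qed.

Lemma PbarE (la mu nu : seq nat) :
  mu != la -> Pbar la mu nu = weight qv tv 1 0 la mu nu.
Proof. by rewrite /Pbar /betabar !alphabarE => /negbTE ->. Qed.

Lemma Pbar_diag (la nu : seq nat) (y : nat) : noninc la -> noninc nu ->
  (forall k, nth 0%N nu k = (nth 0%N la k + (k == y))%N) ->
  Pbar la la nu = tv ^+ y * galpha qv tv 1 0 nu la.
Proof.
move=> la_dec nu_dec nuE; rewrite /Pbar eqxx alphabarE /nskew.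
by rewrite (nfun_addcell la_dec nu_dec nuE) PoszD addrAC subrr add0r.
Qed.

Lemma DsetP (la mu : seq nat) : all (fun p => 0 < p)%N la -> mu \in Dset la ->
  exists i, [/\ noninc mu, forall k, nth 0%N la k = (nth 0%N mu k + (k == i))%N
              & (size mu <= size la)%N].
Proof.
move=> la_pos /mapP[s]; rewrite mem_filter => /andP[/sorted_noninc s_dec /mapP[i]].
rewrite mem_iota => /andP[_ i_lt] sE ->; exists i; rewrite sE in s_dec *.
by apply: remove_cellP => //; apply: (all_nthP 0%N la_pos).
Qed.

Theorem theorem4p14 (la : seq nat) :
  is_partition la ->
  (forall mu, mu \in Dset la -> \sum_(nu <- Uset la) Pdown la mu nu = 1) /\
  (forall nu, nu \in Uset la -> \sum_(mu <- Dstar la) Pbar la mu nu = 1).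
Proof.
case/andP=> /sorted_noninc la_dec la_pos; split=> [mu|nu].
  case/(DsetP la_pos) => m [mu_dec laE size_mu].
  under eq_bigr do rewrite PdownE.
  exact: sum_weight_t qv_neq0 tv_neq0 qt_monom_inj _ _ _ la_dec mu_dec laE size_mu.
rewrite mem_filter => /andP[/sorted_noninc nu_dec /mapP[y _ nu_def]].
have nuE k : nth 0%N nu k = (nth 0%N la k + (k == y))%N.
  by rewrite nu_def nth_incr_nth addnC eq_sym.
rewrite big_cons (Pbar_diag la_dec nu_dec nuE).
rewrite -[RHS](sum_weight_q qv_neq0 tv_neq0 qt_monom_inj la_dec la_pos nu_dec nuE).
congr (_ + _); apply: eq_big_seq => mu /(DsetP la_pos)[m [_ laE _]].
by apply: PbarE; apply/eqP => mu_la; have := laE m; rewrite mu_la eqxx; lia.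
Qed.
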